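(* Let $X \in 2^\omega$ be a 2-generic real. Then $X' \not\leq_{tt} X \oplus 0'$.
   Context: Reals are elements of Cantor space $2^\omega$, identified with subsets of $\omega$. For $X\in 2^\omega$ and $l\in\omega$, $X\upharpoonright l$ is the initial segment of $X$ of length $l$. A real $X$ is $n$-generic if for every $\Sigma^0_n$ set $S$ of finite binary strings, either there is $l$ with $X\upharpoonright l \in S$, or there is $l$ such that no string $\tau \supseteq X\upharpoonright l$ lies in $S$. A Turing functional $\Phi$ is a truth-table reduction if there is a computable $f:\omega\to\omega$ such that for every $n$ and every string $\sigma$ of length $f(n)$, $\Phi^\sigma(n)$ converges; $A \leq_{tt} B$ means $\Phi(B)=A$ for some truth-table reduction $\Phi$. $X' = \{e : \{e\}^X(e)\downarrow\}$ is the Turing jump of $X$, $0'$ is the halting set, and $A\oplus B$ is the join $\{2n : n\in A\}\cup\{2n+1 : n \in B\}$. *)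

(* Defs.v *)
From mathcomp Require Import all_boot.
Set Implicit Arguments. Unset Strict Implicit. Unset Printing Implicit Defensive.

Definition pair (x y : nat) : nat := ((x + y) * (x + y).+1) %/ 2 + y.
Definition unpair_next (p : nat * nat) : nat * nat :=
  match p.1 with
  | x'.+1 => (x', p.2.+1)
  | 0 => (p.2.+1, 0)
  end.
(* unpair n = the n-th pair in Cantor order; inverse of [pair] *)
Definition unpair (n : nat) : nat * nat := iter n unpair_next (0, 0).

Inductive code : Type :=
  | CZero | CSucc | CId | CFst | CSnd
  | COrc
  | CComp of code & code
  | CPair of code & code
  | CPrim of code & code
  | CMin of code.

(* An oracle is a relation: [O x b] means the oracle answers b on query x.
   A query with no answer makes the computation diverge. *)
Definition oracle := nat -> bool -> Prop.

Inductive eval (O : oracle) : code -> nat -> nat -> Prop :=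
  | ev_zero x : eval O CZero x 0
  | ev_succ x : eval O CSucc x x.+1
  | ev_id x : eval O CId x x
  | ev_fst x : eval O CFst x (unpair x).1
  | ev_snd x : eval O CSnd x (unpair x).2
  | ev_orc x (b : bool) : O x b -> eval O COrc x (nat_of_bool b)
  | ev_comp f g x y z : eval O g x y -> eval O f y z -> eval O (CComp f g) x z
  | ev_pair f g x a b : eval O f x a -> eval O g x b -> eval O (CPair f g) x (pair a b)
  | ev_prim0 f g x y z : unpair x = (0, y) -> eval O f y z -> eval O (CPrim f g) x z
  | ev_primS f g x n y r z : unpair x = (n.+1, y) ->
      eval O (CPrim f g) (pair n y) r -> eval O g (pair (pair n y) r) z ->
      eval O (CPrim f g) x z
  | ev_min f x n (vs : nat -> nat) :
      eval O f (pair n x) 0 ->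
      (forall m, m < n -> vs m <> 0 /\ eval O f (pair m x) (vs m)) ->
      eval O (CMin f) x n.

(* ---------- Goedel numbering of codes (surjective) ---------- *)
Fixpoint decode_aux (k e : nat) : code :=
  match k with
  | 0 => CZero
  | k'.+1 =>
    let r := e %/ 10 in
    match e %% 10 with
    | 0 => CZero | 1 => CSucc | 2 => CId | 3 => CFst | 4 => CSnd | 5 => COrc
    | 6 => CComp (decode_aux k' (unpair r).1) (decode_aux k' (unpair r).2)
    | 7 => CPair (decode_aux k' (unpair r).1) (decode_aux k' (unpair r).2)
    | 8 => CPrim (decode_aux k' (unpair r).1) (decode_aux k' (unpair r).2)
    | _ => CMin (decode_aux k' r)
    end
  end.
Definition decode (e : nat) : code := decode_aux e.+1 e.

Definition set := nat -> Prop.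
Definition real := nat -> bool.
Definition set_of_real (X : real) : set := fun n => X n = true.

Definition set_oracle (A : set) : oracle := fun x b => (b = true <-> A x).
Definition str_oracle (s : seq bool) : oracle := fun x b => x < size s /\ nth false s x = b.
Definition empty_oracle : oracle := fun _ _ => False.

Definition restr (X : real) (l : nat) : seq bool := mkseq X l.

Definition join (A B : set) : set :=
  fun n => if odd n then B n./2 else A n./2.

Definition jump (A : set) : set :=
  fun e => exists v, eval (set_oracle A) (decode e) e v.
Definition halting : set := jump (fun _ => False).

Definition computable_fun (f : nat -> nat) : Prop :=
  exists c, forall n, eval empty_oracle c n (f n).

Definition computes_set (Phi : code) (B A : set) : Prop :=
  forall n, exists v, eval (set_oracle B) Phi n v /\
                      ((A n /\ v = 1) \/ (~ A n /\ v = 0)).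

Definition tt_reduction (Phi : code) : Prop :=
  exists f, computable_fun f /\
    forall n (s : seq bool), size s = f n -> exists v, eval (str_oracle s) Phi n v.

Definition tt_le (A B : set) : Prop :=
  exists Phi, tt_reduction Phi /\ computes_set Phi B A.

Definition computable_set (P : set) : Prop :=
  exists c, forall x, exists v, eval empty_oracle c x v /\
                      ((P x /\ v = 1) \/ (~ P x /\ v = 0)).

Fixpoint Sigma (k : nat) (P : set) : Prop :=
  match k with
  | 0 => computable_set P
  | k'.+1 => exists Q : set, Sigma k' (fun z => ~ Q z) /\
                             forall x, P x <-> exists y, Q (pair x y)
  end.

Fixpoint str_code (s : seq bool) : nat :=
  match s with
  | [::] => 1
  | b :: s' => (str_code s').*2 + nat_of_bool b
  end.

Definition SigmaStr (k : nat) (S : seq bool -> Prop) : Prop :=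
  Sigma k (fun m => exists s, m = str_code s /\ S s).

Definition generic (n : nat) (X : real) : Prop :=
  forall S : seq bool -> Prop, SigmaStr n S ->
    (exists l, S (restr X l)) \/
    (exists l, forall t : seq bool, prefix (restr X l) t -> ~ S t).

(* Main.v *)
(** Let [f] bound the use of a truth-table reduction [Phi] of [X'] to [X + 0'].
    There is a code whose computation on input [e] with oracle [Y] halts if and
    only if [Y (f e + e) = 1]; since the jump runs code [e] on input [e], no
    recursion theorem is needed to obtain infinitely many indices [e] (by
    padding) with [X' e = X (f e + e)].  For these [e] the reduction predicts the
    bit of [X] at [f e + e] from [0'] and earlier bits of [X] only.  The strings
    on which some such prediction fails form a dense set, which is [Sigma_2]
    because [0'] is [Sigma_1]: guess [0'] below [f e], with a common stage by
    which the positive answers are confirmed, and check that no negative answer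
    is ever refuted.  A 2-generic [X] has an initial segment in this set, which
    is a contradiction. *)
Require Import Defs.
From mathcomp Require Import all_boot.
From mathcomp Require Import zify.
From Stdlib Require Import Classical.

(** * The Cantor pairing as a bijection *)

Lemma triangularS n : (n.+1 * n.+2) %/ 2 = (n * n.+1) %/ 2 + n.+1.
Proof.
have -> : n.+1 * n.+2 = n.+1 * 2 + n * n.+1 by lia.
by rewrite divnMDl // addnC.
Qed.

Lemma pair_next p : pair (unpair_next p).1 (unpair_next p).2 = (pair p.1 p.2).+1.
Proof.
case: p => -[|x] y; rewrite /pair /=; last by rewrite addnS addSn addnS.
by rewrite !addn0 !add0n triangularS addnS.
Qed.

Lemma pair_unpair n : pair (unpair n).1 (unpair n).2 = n.
Proof. by elim: n => // n IH; rewrite /unpair iterS pair_next IH. Qed.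

(** Induction follows the enumeration: outer on the antidiagonal [x + y], inner on [y]; the first
    pair [(s.+1, 0)] of a diagonal succeeds the last pair [(0, s)] of the previous one. *)
Lemma unpair_surj p : exists n, unpair n = p.
Proof.
case: p => x y; elim: {x y}(x + y) {-2}x {-2}y (erefl (x + y)) => [|s IHs] x y.
  by case: x => //; case: y => // _; exists 0.
elim: y x => [|y IHy] x.
  rewrite addn0 => ->; have [|n En] := IHs 0 s; first by rewrite add0n.
  by exists n.+1; rewrite /unpair iterS -/(unpair n) En.
move=> E; have [|n En] := IHy x.+1; first by rewrite -E addnS addSn.
by exists n.+1; rewrite /unpair iterS -/(unpair n) En.
Qed.

Lemma unpair_pair x y : unpair (pair x y) = (x, y).
Proof.
have [n En] := unpair_surj (x, y).
by have := pair_unpair n; rewrite En /= => ->.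
Qed.

Lemma leq_pair x y : x + y <= pair x y.
Proof.
rewrite /pair; case: (x + y) (leq_addl x y) => [|n] _ //.
by rewrite triangularS; lia.
Qed.

Lemma leq_unpair n : (unpair n).1 <= n /\ (unpair n).2 <= n.
Proof. by have := leq_pair (unpair n).1 (unpair n).2; rewrite pair_unpair; lia. Qed.

(** * Codes and evaluation *)

(* The generated principle gives no hypothesis under the conjunction of [ev_min]. *)
Lemma eval_nested_ind (O : oracle) (P : code -> nat -> nat -> Prop) :
  (forall x, P CZero x 0) -> (forall x, P CSucc x x.+1) ->
  (forall x, P CId x x) ->
  (forall x, P CFst x (unpair x).1) -> (forall x, P CSnd x (unpair x).2) ->
  (forall x (b : bool), O x b -> P COrc x b) ->
  (forall f g x y z, P g x y -> P f y z -> P (CComp f g) x z) ->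
  (forall f g x a b, P f x a -> P g x b -> P (CPair f g) x (pair a b)) ->
  (forall f g x y z, unpair x = (0, y) -> P f y z -> P (CPrim f g) x z) ->
  (forall f g x n y r z, unpair x = (n.+1, y) -> P (CPrim f g) (pair n y) r ->
     P g (pair (pair n y) r) z -> P (CPrim f g) x z) ->
  (forall f x n (vs : nat -> nat), P f (pair n x) 0 ->
     (forall m, m < n -> vs m <> 0 /\ P f (pair m x) (vs m)) -> P (CMin f) x n) ->
  forall c x v, eval O c x v -> P c x v.
Proof.
move=> h0 h1 h2 h3 h4 h5 h6 h7 h8 h9 h10.
fix IH 4 => c x v []; [by []|by []|by []|by []|by []|by []| | | | |].
- move=> f g {}x y z Hg Hf; exact: h6 (IH _ _ _ Hg) (IH _ _ _ Hf).
- move=> f g {}x a b Hf Hg; exact: h7 (IH _ _ _ Hf) (IH _ _ _ Hg).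
- move=> f g {}x y z E H; exact: h8 E (IH _ _ _ H).
- move=> f g {}x n y r z E H H'; exact: h9 E (IH _ _ _ H) (IH _ _ _ H').
- move=> f {}x n vs H Hm; apply: h10 (IH _ _ _ H) _ => m lt_mn.
  by case: (Hm m lt_mn) => nz H'; split; [exact: nz | exact: IH H'].
Qed.

(** This carries a computation on a finite string over to every oracle that extends it. *)
Lemma eval_mono (O O' : oracle) : (forall x b, O x b -> O' x b) ->
  forall c x v, eval O c x v -> eval O' c x v.
Proof.
move=> sub; apply: eval_nested_ind; try by constructor.
- by move=> x b /sub; constructor.
- by move=> f g x y z; apply: ev_comp.
- by move=> f g x y z; apply: ev_prim0.
- by move=> f g x n y r z; apply: ev_primS.
- by move=> f x n vs; apply: ev_min.
Qed.

Definition functional_oracle (O : oracle) : Prop :=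
  forall x b b', O x b -> O x b' -> b = b'.

Lemma eval_fun (O : oracle) : functional_oracle O ->
  forall c x v w, eval O c x v -> eval O c x w -> v = w.
Proof.
move=> funO c x v w H; move: c x v H w.
apply: eval_nested_ind.
1-5: by move=> x w H; inversion H.
- move=> x b Ob w H.
  inversion H as [| | | | |? b' Ob'| | | | |].
  by rewrite (funO _ _ _ Ob Ob').
- move=> f g x y z IHg IHf w H.
  inversion H as [| | | | | |? ? ? y' ? Hg Hf| | | |].
  by move: Hf; rewrite -(IHg _ Hg) => /IHf.
- move=> f g x a b IHf IHg w H.
  inversion H as [| | | | | | |? ? ? a' b' Hf Hg| | |].
  by rewrite (IHf _ Hf) (IHg _ Hg).
- move=> f g x y z E IHf w H.
  inversion H as [| | | | | | | |? ? ? y' ? E' Hf|? ? ? n y' r ? E' Hr Hg|]; last by move: E'; rewrite E.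
  by move: E' Hf; rewrite E => -[<-] /IHf.
- move=> f g x n y r z E IH1 IH2 w H.
  inversion H as [| | | | | | | |? ? ? y' ? E' Hf|? ? ? n' y' r' ? E' Hr Hg|]; first by move: E'; rewrite E.
  move: E' Hr Hg; rewrite E => -[<- <-] Hr.
  by rewrite -(IH1 _ Hr) => /IH2.
- move=> f x n vs IH0 IHm w H.
  inversion H as [| | | | | | | | | |? ? ? ws H0 Hm].
  (* If two searches ended at different places, the smaller one would give [f] both a zero and a
     nonzero value there. *)
  case: (ltngtP n w) => // lt.
  + by case: (Hm _ lt) => nz /IH0 /esym.
  + by case: (IHm _ lt) => nz IH; move/IH: H0.
Qed.

Lemma eval_comp_inv {O f g x z} : eval O (CComp f g) x z ->
  exists2 y, eval O g x y & eval O f y z.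
Proof. by move=> H; inversion H as [| | | | | |? ? ? y ? Hg Hf| | | |]; exists y. Qed.

Lemma eval_orc_inv {O x y} : eval O COrc x y -> exists2 b : bool, O x b & y = b.
Proof. by move=> H; inversion H as [| | | | |? b Ob| | | | |]; exists b. Qed.

Lemma eval_min_inv {O f x n} : eval O (CMin f) x n -> eval O f (pair n x) 0.
Proof. by move=> H; inversion H. Qed.

Lemma set_functional A : functional_oracle (set_oracle A).
Proof. by move=> x b b' h h'; apply/idP/idP => [/h/h'|/h'/h]. Qed.

Lemma eval_empty (O : oracle) c x v : eval empty_oracle c x v -> eval O c x v.
Proof. by apply: eval_mono. Qed.

(** * Computable functions *)

Lemma computable_ext f g : f =1 g -> computable_fun f -> computable_fun g.
Proof. by move=> fg [c Hc]; exists c => n; rewrite -fg. Qed.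

Lemma computable_id : computable_fun (fun x => x).
Proof. by exists CId; constructor. Qed.

Lemma computable_comp h f :
  computable_fun h -> computable_fun f -> computable_fun (fun x => h (f x)).
Proof. by move=> [c Hc] [d Hd]; exists (CComp c d) => n; apply: ev_comp. Qed.

Lemma computable_succ f : computable_fun f -> computable_fun (fun x => (f x).+1).
Proof. by apply: (computable_comp S); exists CSucc; constructor. Qed.

Lemma computable_const n : computable_fun (fun _ => n).
Proof.
elim: n => [|n IH]; last exact: computable_succ.
by exists CZero; constructor.
Qed.

Lemma computable_fst f : computable_fun f -> computable_fun (fun x => (unpair (f x)).1).
Proof. by apply: (computable_comp (fun x => (unpair x).1)); exists CFst; constructor. Qed.

Lemma computable_snd f : computable_fun f -> computable_fun (fun x => (unpair (f x)).2).
Proof. by apply: (computable_comp (fun x => (unpair x).2)); exists CSnd; constructor. Qed.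

Lemma computable_pair f g : computable_fun f -> computable_fun g ->
  computable_fun (fun x => pair (f x) (g x)).
Proof. by move=> [c Hc] [d Hd]; exists (CPair c d) => n; constructor. Qed.

(** [CPrim] feeds its step code [pair (pair n x) r], whence the shape of the hypothesis on [H]. *)
Lemma computable_nat_rect (H : nat -> nat -> nat -> nat) A N :
  computable_fun (fun z => H (unpair (unpair z).1).1 (unpair (unpair z).1).2 (unpair z).2) ->
  computable_fun A -> computable_fun N ->
  computable_fun (fun x => nat_rect (fun=> nat) (A x) (fun n r => H n x r) (N x)).
Proof.
move=> [h Hh] [a Ha] [n Hn].
exists (CComp (CPrim a h) (CPair n CId)) => x.
apply: ev_comp; first by apply: ev_pair; [exact: Hn | constructor].
elim: (N x) => [|k IH] /=.
  by apply: ev_prim0 (Ha x); rewrite unpair_pair.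
apply: ev_primS IH _; first by rewrite unpair_pair.
by have := Hh (pair (pair k x) (nat_rect (fun=> nat) (A x) (fun n r => H n x r) k));
  rewrite !unpair_pair.
Qed.

Lemma computable_iter (H : nat -> nat -> nat) A N :
  computable_fun (fun z => H (unpair z).1 (unpair z).2) ->
  computable_fun A -> computable_fun N ->
  computable_fun (fun x => iter (N x) (H x) (A x)).
Proof.
move=> cH cA cN; apply: computable_ext (computable_nat_rect (fun _ => H) A N _ cA cN).
  by move=> x; elim: (N x) => //= n ->.
apply: computable_ext (computable_comp _ (fun z => pair (unpair (unpair z).1).2 (unpair z).2) cH _).
  by move=> z; rewrite unpair_pair.
by apply: computable_pair; do ?[apply: computable_fst|apply: computable_snd]; apply: computable_id.
Qed.

Lemma computable_if0 N F G :
  computable_fun N -> computable_fun F -> computable_fun G ->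
  computable_fun (fun x => if N x == 0 then F x else G x).
Proof.
move=> cN cF cG.
(* Iterating a constant map is a case distinction: no iteration leaves [F x], any positive number
   gives [G x]. *)
apply: computable_ext (computable_iter (fun x _ => G x) F N _ cF cN).
  by move=> x; case: (N x).
by apply: computable_comp => //; apply: computable_fst; apply: computable_id.
Qed.

Lemma computable_add f g : computable_fun f -> computable_fun g ->
  computable_fun (fun x => f x + g x).
Proof.
move=> cf cg; apply: computable_ext (computable_iter (fun _ => S) g f _ cg cf).
  by move=> x; rewrite iter_succn addnC.
by apply: computable_succ; apply: computable_snd; apply: computable_id.
Qed.

Lemma computable_pred f : computable_fun f -> computable_fun (fun x => (f x).-1).
Proof.
move=> cf; apply: computable_ext
  (computable_nat_rect (fun n _ _ => n) (fun _ => 0) f _ (computable_const 0) cf).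
  by move=> x; case: (f x).
by do 2!apply: computable_fst; apply: computable_id.
Qed.

Lemma computable_sub f g : computable_fun f -> computable_fun g ->
  computable_fun (fun x => f x - g x).
Proof.
move=> cf cg; apply: computable_ext (computable_iter (fun _ => predn) f g _ cf cg).
  by move=> x; rewrite iter_predn.
by apply: computable_pred; apply: computable_snd; apply: computable_id.
Qed.

Lemma computable_mul f g : computable_fun f -> computable_fun g ->
  computable_fun (fun x => f x * g x).
Proof.
move=> cf cg; apply: computable_ext
  (computable_iter (fun x => addn (g x)) (fun _ => 0) f _ (computable_const 0) cf).
  by move=> x; rewrite iter_addn_0 mulnC.
apply: computable_add; first (apply: computable_comp => //; apply: computable_fst);
  last apply: computable_snd; exact: computable_id.
Qed.

Lemma computable_ifeq A B F G :
  computable_fun A -> computable_fun B -> computable_fun F -> computable_fun G ->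
  computable_fun (fun x => if A x == B x then F x else G x).
Proof.
move=> cA cB cF cG.
apply: (computable_ext (fun x => if (A x - B x) + (B x - A x) == 0 then F x else G x)).
  by move=> x; rewrite addn_eq0 !subn_eq0 -eqn_leq.
by apply: computable_if0 => //; apply: computable_add; apply: computable_sub.
Qed.

(** The numbering of codes keeps the constructor in the last decimal digit, so the machine has to
    read it. *)
Lemma computable_mod10 f : computable_fun f -> computable_fun (fun x => f x %% 10).
Proof.
move=> cf; apply: computable_ext (computable_iter
  (fun _ r => if r == 9 then 0 else r.+1) (fun _ => 0) f _ (computable_const 0) cf).
  move=> x; elim: (f x) => //= n ->; rewrite modnS.
  by have := ltn_pmod n (isT : 0 < 10); case: ifP; case: ifP; lia.
have csnd := computable_snd _ computable_id.
apply: computable_ifeq => //; try exact: computable_const.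
exact: computable_succ.
Qed.

Lemma computable_div10 f : computable_fun f -> computable_fun (fun x => f x %/ 10).
Proof.
move=> cf; apply: computable_ext (computable_nat_rect
  (fun n _ r => if n.+1 %% 10 == 0 then r.+1 else r) (fun _ => 0) f _ (computable_const 0) cf).
  by move=> x; elim: (f x) => //= n ->; rewrite divnS // /dvdn; case: ifP.
have csnd := computable_snd _ computable_id.
apply: computable_ifeq => //; try exact: computable_const.
  apply: computable_mod10; apply: computable_succ.
  by do 2!apply: computable_fst; apply: computable_id.
exact: computable_succ.
Qed.

Lemma computable_half f : computable_fun f -> computable_fun (fun x => (f x)./2).
Proof.
(* The recursion rests on [n.+1./2 = n - n./2]. *)
move=> cf; apply: computable_ext (computable_nat_rect
  (fun n _ r => n - r) (fun _ => 0) f _ (computable_const 0) cf).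
  by move=> x; elim: (f x) => //= n ->; rewrite uphalf_half; have := odd_double_half n; lia.
apply: computable_sub; last apply: computable_snd; last exact: computable_id.
by do 2!apply: computable_fst; apply: computable_id.
Qed.

Lemma computable_odd f : computable_fun f -> computable_fun (fun x => nat_of_bool (odd (f x))).
Proof.
move=> cf; apply: computable_ext (computable_iter
  (fun _ r => 1 - r) (fun _ => 0) f _ (computable_const 0) cf).
  by move=> x; elim: (f x) => //= n ->; case: (odd n).
apply: computable_sub; first exact: computable_const.
apply: computable_snd; exact: computable_id.
Qed.

(** * Numbers as finite oracles, read through their binary digits *)

Definition shiftr (m i : nat) : nat := iter i half m.
Definition bit (m i : nat) : bool := odd (shiftr m i).

Lemma shiftr0 i : shiftr 0 i = 0.
Proof. by elim: i => //= i ->. Qed.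

Lemma computable_shiftr f g : computable_fun f -> computable_fun g ->
  computable_fun (fun x => shiftr (f x) (g x)).
Proof.
move=> cf cg; apply: computable_iter => //.
by apply: computable_half; apply: computable_snd; apply: computable_id.
Qed.

Lemma computable_bit f g : computable_fun f -> computable_fun g ->
  computable_fun (fun x => nat_of_bool (bit (f x) (g x))).
Proof. by move=> cf cg; apply/computable_odd/computable_shiftr. Qed.

(** Descends along the syntax of the function; subterms of unknown shape are left as goals. *)
Ltac computability :=
  lazymatch goal with
  | |- computable_fun (fun _ => ?n) => exact: computable_const
  | |- computable_fun (fun x => x) => exact: computable_id
  | |- computable_fun (fun x => (unpair (@?A x)).1) => apply: (computable_fst A); computability
  | |- computable_fun (fun x => (unpair (@?A x)).2) => apply: (computable_snd A); computability
  | |- computable_fun (fun x => pair (@?A x) (@?B x)) => apply: (computable_pair A B); computability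
  | |- computable_fun (fun x => @?A x + @?B x) => apply: (computable_add A B); computability
  | |- computable_fun (fun x => @?A x - @?B x) => apply: (computable_sub A B); computability
  | |- computable_fun (fun x => @?A x * @?B x) => apply: (computable_mul A B); computability
  | |- computable_fun (fun x => @?A x %% 10) => apply: (computable_mod10 A); computability
  | |- computable_fun (fun x => @?A x %/ 10) => apply: (computable_div10 A); computability
  | |- computable_fun (fun x => half (@?A x)) => apply: (computable_half A); computability
  | |- computable_fun (fun x => nat_of_bool (odd (@?A x))) => apply: (computable_odd A); computability
  | |- computable_fun (fun x => shiftr (@?A x) (@?B x)) => apply: (computable_shiftr A B); computability
  | |- computable_fun (fun x => nat_of_bool (bit (@?A x) (@?B x))) => apply: (computable_bit A B); computability
  | |- computable_fun (fun x => (@?A x).-1) => apply: (computable_pred A); computability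
  | |- computable_fun (fun x => (@?A x).+1) => apply: (computable_succ A); computability
  | |- computable_fun (fun x => ?h (@?A x)) => try (apply: (computable_comp h A); [by [] | computability])
  | _ => try (apply: computable_ifeq; computability)
  end.

(** * A universal stack machine *)

(** The successor keeps nonempty stacks apart from the empty one. *)
Definition push (fr K : nat) : nat := (pair fr K).+1.

(* A state is [pair K v] with [K] a stack of frames ([0] is empty) and [v] the
   current value.  Frames: [pair 0 e] runs code [e] on [v];
   [pair 1 (pair g x)] keeps [v] and runs [g] on [x]; [pair 2 a] pairs [a]
   with [v]; [pair 3 (pair g p)] runs [g] on [pair p v];
   [pair 4 (pair f (pair n x))] tests [v] in the search of [CMin f] at [n]. *)
Definition exec (m e v K : nat) : nat :=
  if e %% 10 == 0 then pair K 0 else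
  if e %% 10 == 1 then pair K v.+1 else
  if e %% 10 == 2 then pair K v else
  if e %% 10 == 3 then pair K (unpair v).1 else
  if e %% 10 == 4 then pair K (unpair v).2 else
  if e %% 10 == 5 then pair K (bit m v) else
  if e %% 10 == 6 then
    pair (push (pair 0 (unpair (e %/ 10)).2) (push (pair 0 (unpair (e %/ 10)).1) K)) v else
  if e %% 10 == 7 then
    pair (push (pair 0 (unpair (e %/ 10)).1)
         (push (pair 1 (pair (unpair (e %/ 10)).2 v)) K)) v else
  if e %% 10 == 8 then
    if (unpair v).1 == 0 then pair (push (pair 0 (unpair (e %/ 10)).1) K) (unpair v).2 else
    pair (push (pair 0 e)
         (push (pair 3 (pair (unpair (e %/ 10)).2 (pair (unpair v).1.-1 (unpair v).2))) K))
         (pair (unpair v).1.-1 (unpair v).2)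
  else pair (push (pair 0 (e %/ 10)) (push (pair 4 (pair (e %/ 10) (pair 0 v))) K)) (pair 0 v).

Definition resume (t p v K : nat) : nat :=
  if t == 1 then pair (push (pair 0 (unpair p).1) (push (pair 2 v) K)) (unpair p).2 else
  if t == 2 then pair K (pair p v) else
  if t == 3 then pair (push (pair 0 (unpair p).1) K) (pair (unpair p).2 v) else
  if v == 0 then pair K (unpair (unpair p).2).1 else
  pair (push (pair 0 (unpair p).1)
       (push (pair 4 (pair (unpair p).1
               (pair (unpair (unpair p).2).1.+1 (unpair (unpair p).2).2))) K))
       (pair (unpair (unpair p).2).1.+1 (unpair (unpair p).2).2).

(** States with an empty stack are fixed points, so a halted run stays halted at all later
    stages. *)
Definition step (m s : nat) : nat :=
  if (unpair s).1 == 0 then s else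
  if (unpair (unpair (unpair s).1.-1).1).1 == 0 then
    exec m (unpair (unpair (unpair s).1.-1).1).2 (unpair s).2 (unpair (unpair s).1.-1).2
  else resume (unpair (unpair (unpair s).1.-1).1).1 (unpair (unpair (unpair s).1.-1).1).2
         (unpair s).2 (unpair (unpair s).1.-1).2.

Lemma computable_step : computable_fun (fun z => step (unpair z).1 (unpair z).2).
Proof. by rewrite /step /exec /resume /push; computability. Qed.

Definition run (m e x n : nat) : nat := iter n (step m) (pair (push (pair 0 e) 0) x).

Lemma computable_run A B C D : computable_fun A -> computable_fun B ->
  computable_fun C -> computable_fun D ->
  computable_fun (fun x => run (A x) (B x) (C x) (D x)).
Proof.
move=> cA cB cC cD; apply: computable_iter => //.
  apply: computable_ext (computable_comp _ (fun z => pair (A (unpair z).1) (unpair z).2)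
    computable_step _); first by move=> z; rewrite unpair_pair.
  by computability.
by rewrite /push; computability.
Qed.

(** * Correctness of the stack machine *)

Lemma decode_aux_fuel k k' e : e < k -> e < k' -> decode_aux k e = decode_aux k' e.
Proof.
elim: k k' e => // k IH [|k'] // e lt_ek lt_ek' /=.
have lt_r a : a <= e %/ 10 -> 5 < e %% 10 -> a < k /\ a < k' by lia.
have [le1 le2] := leq_unpair (e %/ 10).
case E : (e %% 10) => [|[|[|[|[|[|[|[|[|t]]]]]]]]] //.
1-3: by f_equal; apply: IH; have := lt_r _ le1; have := lt_r _ le2; rewrite E; lia.
by f_equal; apply: IH; have := lt_r _ (leqnn _); rewrite E; lia.
Qed.

Lemma decodeE e : decode e =
  let r := e %/ 10 in
  match e %% 10 with
  | 0 => CZero | 1 => CSucc | 2 => CId | 3 => CFst | 4 => CSnd | 5 => COrc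
  | 6 => CComp (decode (unpair r).1) (decode (unpair r).2)
  | 7 => CPair (decode (unpair r).1) (decode (unpair r).2)
  | 8 => CPrim (decode (unpair r).1) (decode (unpair r).2)
  | _ => CMin (decode r)
  end.
Proof.
rewrite {1}/decode /=.
have lt_r a : a <= e %/ 10 -> 5 < e %% 10 -> a < e by lia.
have [le1 le2] := leq_unpair (e %/ 10).
case E : (e %% 10) => [|[|[|[|[|[|[|[|[|t]]]]]]]]] //.
1-3: by f_equal; apply: decode_aux_fuel => //; apply: lt_r; rewrite ?E.
by f_equal; apply: decode_aux_fuel => //; apply: lt_r; rewrite ?E.
Qed.

Definition bit_oracle (m : nat) : oracle := fun x b => b = bit m x.

Lemma bit_functional m : functional_oracle (bit_oracle m).
Proof. by move=> x b b' -> ->. Qed.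

Lemma step_exec m e K v : step m (pair (push (pair 0 e) K) v) = exec m e v K.
Proof. by rewrite /step /push !unpair_pair. Qed.

Lemma step_resume m t p K v :
  step m (pair (push (pair t.+1 p) K) v) = resume t.+1 p v K.
Proof. by rewrite /step /push !unpair_pair. Qed.

Definition reach (m s s' : nat) : Prop := exists n, iter n (step m) s = s'.

Lemma reach_refl m s : reach m s s.
Proof. by exists 0. Qed.

Lemma reach_trans m s2 s1 s3 : reach m s1 s2 -> reach m s2 s3 -> reach m s1 s3.
Proof. by move=> [n <-] [k <-]; exists (k + n); rewrite iterD. Qed.

Lemma reach_step m s s' : reach m (step m s) s' -> reach m s s'.
Proof. by apply: reach_trans; exists 1. Qed.

(** A code has many indices, and the completeness proof must treat all of them; the shape of the
    code still determines the last digit. *)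
Lemma decode_inv e :
  let r := e %/ 10 in
  match decode e with
  | CZero => e %% 10 = 0 | CSucc => e %% 10 = 1 | CId => e %% 10 = 2
  | CFst => e %% 10 = 3 | CSnd => e %% 10 = 4 | COrc => e %% 10 = 5
  | CComp f g => [/\ e %% 10 = 6, decode (unpair r).1 = f & decode (unpair r).2 = g]
  | CPair f g => [/\ e %% 10 = 7, decode (unpair r).1 = f & decode (unpair r).2 = g]
  | CPrim f g => [/\ e %% 10 = 8, decode (unpair r).1 = f & decode (unpair r).2 = g]
  | CMin f => e %% 10 = 9 /\ decode r = f
  end.
Proof.
rewrite decodeE /=; have := ltn_pmod e (isT : 0 < 10).
by case: (e %% 10) => [|[|[|[|[|[|[|[|[|[|t]]]]]]]]]].
Qed.

(** The stack [K] is arbitrary so that the induction hypotheses apply to subcomputations run above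
    further frames. *)
Lemma machine_complete m c x v : eval (bit_oracle m) c x v ->
  forall e K, decode e = c -> reach m (pair (push (pair 0 e) K) x) (pair K v).
Proof.
move: c x v; apply: eval_nested_ind.
1-5: by move=> x e K De; have := decode_inv e; rewrite De => E;
  apply: reach_step; rewrite step_exec /exec E; apply: reach_refl.
- move=> x b Ob e K De; have := decode_inv e; rewrite De => E.
  by apply: reach_step; rewrite step_exec /exec E Ob; apply: reach_refl.
- move=> f g x y z IHg IHf e K De; have := decode_inv e; rewrite De => -[E Df Dg].
  apply: reach_step; rewrite step_exec /exec E /=.
  by apply: reach_trans (IHg _ _ Dg) (IHf _ _ Df).
- move=> f g x a b IHf IHg e K De; have := decode_inv e; rewrite De => -[E Df Dg].
  apply: reach_step; rewrite step_exec /exec E /=.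
  apply: reach_trans (IHf _ _ Df) _; apply: reach_step.
  rewrite step_resume /resume /= !unpair_pair /=.
  apply: reach_trans (IHg _ _ Dg) _; apply: reach_step.
  by rewrite step_resume /resume /=; apply: reach_refl.
- move=> f g x y z Ex IHf e K De; have := decode_inv e; rewrite De => -[E Df Dg].
  by apply: reach_step; rewrite step_exec /exec E Ex /=; apply: IHf.
- move=> f g x n y r z Ex IH1 IH2 e K De; have := decode_inv e; rewrite De => -[E Df Dg].
  apply: reach_step; rewrite step_exec /exec E Ex /=.
  apply: reach_trans (IH1 _ _ De) _; apply: reach_step.
  by rewrite step_resume /resume /= !unpair_pair /=; apply: IH2.
- move=> f x n vs IH0 IHm e K De; have := decode_inv e; rewrite De => -[E Df].
  apply: reach_step; rewrite step_exec /exec E /=.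
  (* Induction on the distance [j] from the current candidate to the zero at [n]. *)
  suff search j : j <= n -> reach m
      (pair (push (pair 0 (e %/ 10)) (push (pair 4 (pair (e %/ 10) (pair (n - j) x))) K))
        (pair (n - j) x)) (pair K n).
    by have := search n (leqnn n); rewrite subnn.
  elim: j => [_|j IHj lt_jn].
    rewrite subn0; apply: reach_trans (IH0 _ _ Df) _; apply: reach_step.
    by rewrite step_resume /resume /= !unpair_pair; apply: reach_refl.
  have lt : n - j.+1 < n by lia.
  have [nz IH] := IHm _ lt.
  apply: reach_trans (IH _ _ Df) _; apply: reach_step.
  rewrite step_resume /resume /= !unpair_pair /=.
  move/eqP/negbTE: nz => ->; rewrite subnSK //; apply: IHj; exact: ltnW.
Qed.

Lemma halts_push m fr K v n w : iter n (step m) (pair (push fr K) v) = pair 0 w ->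
  exists2 n', n = n'.+1 & iter n' (step m) (step m (pair (push fr K) v)) = pair 0 w.
Proof.
case: n => [|n]; last by rewrite iterSr; exists n.
by move/(congr1 unpair); rewrite !unpair_pair.
Qed.

(** Strong induction on the number of steps. The strictly shorter run that remains once [e] has
    returned its value lets the hypothesis be applied again to the next frame. *)
Lemma machine_sound m n : forall e K x w,
  iter n (step m) (pair (push (pair 0 e) K) x) = pair 0 w ->
  exists v, eval (bit_oracle m) (decode e) x v /\
    exists2 n', n' < n & iter n' (step m) (pair K v) = pair 0 w.
Proof.
elim/ltn_ind: n => n IH e K x w /halts_push[n1 En]; rewrite step_exec /exec.
have IH1 : forall k, k <= n1 -> forall e K x w,
    iter k (step m) (pair (push (pair 0 e) K) x) = pair 0 w ->
    exists v, eval (bit_oracle m) (decode e) x v /\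
      exists2 n', n' < k & iter n' (step m) (pair K v) = pair 0 w.
  by move=> k lek; apply: IH; rewrite En.
rewrite decodeE /= {IH}En; have := ltn_pmod e (isT : 0 < 10).
case: (e %% 10) (decodeE e) => [|[|[|[|[|[|[|[|[|[|t]]]]]]]]]] //= De _.
1-5: by move=> H; eexists; split; [constructor | exists n1].
- by move=> H; exists (bit m x); split; [constructor | exists n1].
- move=> /IH1[//|y [Hg [n2 lt2 /IH1[|z [Hf [n3 lt3 H]]]]]]; first exact: ltnW.
  by exists z; split; [apply: ev_comp Hg Hf | exists n3; lia].
- move=> /IH1[//|a [Hf [n2 lt2 /halts_push[n3 E3]]]].
  rewrite step_resume /resume /= !unpair_pair => /IH1[|b [Hg [n4 lt4]]]; first by lia.
  move=> /halts_push[n5 E5]; rewrite step_resume /resume /= => H.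
  by exists (pair a b); split; [apply: ev_pair | exists n5; lia].
- case Ex: (unpair x) => [[|k] y] /=.
    move=> /IH1[//|z [Hf [n2 lt2 H]]].
    by exists z; split; [apply: ev_prim0 Ex Hf | exists n2; lia].
  move=> /IH1[//|r [Hr [n2 lt2 /halts_push[n3 E3]]]].
  rewrite step_resume /resume /= !unpair_pair => /IH1[|z [Hg [n4 lt4 H]]]; first by lia.
  rewrite De in Hr.
  by exists z; split; [apply: ev_primS Ex Hr Hg | exists n4; lia].
- set f := e %/ 10.
  (* A search resumed at [j] only accounts for the values from [j] on; [j = 0] gives what [ev_min]
     requires. *)
  suff search k j : k <= n1 -> iter k (step m)
      (pair (push (pair 0 f) (push (pair 4 (pair f (pair j x))) K)) (pair j x)) = pair 0 w ->
    exists v vs, [/\ j <= v, eval (bit_oracle m) (decode f) (pair v x) 0,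
      forall i, j <= i < v -> vs i <> 0 /\ eval (bit_oracle m) (decode f) (pair i x) (vs i) &
      exists2 n', n' < k & iter n' (step m) (pair K v) = pair 0 w].
    move=> /search[//|v [vs [_ H0 Hm [n' lt' H]]]].
    by exists v; split; [apply: ev_min H0 Hm | exists n'; lia].
  elim/ltn_ind: k j => k IHk j lek /IH1[//|r [Hr [n2 lt2 /halts_push[n3 E3]]]].
  rewrite step_resume /resume /= !unpair_pair /=.
  case: eqP => [r0|nz] H.
    by exists j, (fun=> 0); rewrite -{1}r0; split=> //; [move=> i; lia | exists n3; lia].
  have [||v [vs [lejv H0 Hm [n4 lt4 H4]]]] := IHk _ _ _ _ H; try by lia.
  exists v, (fun i => if i == j then r else vs i); split=> //; first exact: ltnW.
    move=> i /andP[leji ltiv]; case: eqP => [-> //|neq]; apply: Hm; lia.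
  by exists n4; lia.
Qed.

Lemma run_halted m e x n k : n <= k -> (unpair (run m e x n)).1 = 0 -> run m e x k = run m e x n.
Proof.
move=> /subnK <- h; rewrite /run iterD; elim: (k - n) => //= i ->.
by rewrite {1}/step -/(run m e x n) h.
Qed.

Lemma run_complete m e x v : eval (bit_oracle m) (decode e) x v ->
  exists n, run m e x n = pair 0 v.
Proof. by move=> /machine_complete; apply. Qed.

Lemma run_sound m e x n : (unpair (run m e x n)).1 = 0 ->
  eval (bit_oracle m) (decode e) x (unpair (run m e x n)).2.
Proof.
move=> h; have := pair_unpair (run m e x n); rewrite h => /esym E.
have [v [Hv [n' _ En']]] := @machine_sound _ _ _ _ _ _ E.
suff -> : (unpair (run m e x n)).2 = v by [].
suff Ev k : iter k (step m) (pair 0 v) = pair 0 v.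
  by move: En'; rewrite Ev => /(congr1 unpair); rewrite !unpair_pair => -[].
by elim: k => //= k ->; rewrite /step unpair_pair.
Qed.

(** All bits of 0 are false, so [bit_oracle 0] answers as the empty set does. This is the Sigma_1
    form of the halting set. *)
Lemma halting_run e : halting e <-> exists n, (unpair (run 0 e e n)).1 = 0.
Proof.
have bit0 i : bit 0 i = false by rewrite /bit shiftr0.
split=> [[v Hv]|[n /run_sound Hn]].
  have [|n Hn] := run_complete 0 e e v; last by exists n; rewrite Hn unpair_pair.
  by apply: eval_mono Hv => x b hb; rewrite /bit_oracle bit0; case: b hb => // -[/(_ erefl)].
exists (unpair (run 0 e e n)).2; apply: eval_mono Hn => x b ->.
by rewrite bit0 /set_oracle.
Qed.

(** * The diagonal set of strings *)

Lemma shiftr_double x b i : shiftr (x.*2 + nat_of_bool b) i.+1 = shiftr x i.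
Proof. by rewrite /shiftr iterSr halfD doubleK odd_double; case: b; rewrite /= ?addn0. Qed.

Lemma bit_double x (b : bool) : bit (x.*2 + b) 0 = b.
Proof. by rewrite /bit /= oddD odd_double; case: b. Qed.

Lemma bit_str_code s i : i < size s -> bit (str_code s) i = nth false s i.
Proof.
elim: s i => // b s IH [|i] /=; first by rewrite bit_double.
by rewrite /bit shiftr_double; apply: IH.
Qed.

(** The leading binary digit of [str_code s] sits at position [size s], so lengths can be tested on
    codes. *)
Lemma shiftr_str_code s i : (shiftr (str_code s) i != 0) = (i <= size s).
Proof.
elim: s i => [|b s IH] [|i].
- by [].
- by rewrite /shiftr iterSr -/(shiftr 0 i) shiftr0.
- by have := IH 0; rewrite /= addn_eq0 double_eq0 => /negbTE ->.
- by rewrite [str_code _]/= shiftr_double IH.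
Qed.

Lemma str_code_surj x : 0 < x -> exists s, x = str_code s.
Proof.
elim/ltn_ind: x => x IH x_gt0; have := odd_double_half x.
case E: (x./2) => [|y] Ex; first by exists [::]; move: x_gt0 Ex; case: (odd x) => /=; lia.
have [||s Es] := IH y.+1; try by lia.
by exists (odd x :: s); rewrite /= -Es; lia.
Qed.

Lemma bits_of_seq s : exists m, forall i, bit m i = nth false s i.
Proof.
elim: s => [|b s [m Hm]].
  by exists 0 => i; rewrite nth_nil /bit shiftr0.
by exists (m.*2 + b) => -[|i]; rewrite ?bit_double // /bit shiftr_double; apply: Hm.
Qed.

Lemma set_initial_segment (A : set) N :
  exists s, size s = N /\ forall i, i < N -> (nth false s i = true <-> A i).
Proof.
elim: N => [|N [s [Es Hs]]]; first by exists [::].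
have [b Hb] : exists b : bool, b = true <-> A N.
  by case: (classic (A N)) => a; [exists true | exists false].
exists (rcons s b); split; first by rewrite size_rcons Es.
by move=> i; rewrite ltnS leq_eqVlt nth_rcons Es => /orP[/eqP->|lt_iN];
  rewrite ?ltnn ?eqxx ?lt_iN //; apply: Hs.
Qed.

(** * Indices, padding and the code that queries one bit *)

Lemma decode_surj c : exists e, decode e = c.
Proof.
have dec t r : t < 10 -> (10 * r + t) %% 10 = t /\ (10 * r + t) %/ 10 = r by lia.
elim: c => [||||||f [a Da] g [b Db]|f [a Da] g [b Db]|f [a Da] g [b Db]|f [a Da]].
- by exists 0.
- by exists 1.
- by exists 2.
- by exists 3.
- by exists 4.
- by exists 5.
- exists (10 * pair a b + 6); rewrite decodeE; have [//|-> ->] := dec 6 (pair a b).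
  by rewrite /= unpair_pair Da Db.
- exists (10 * pair a b + 7); rewrite decodeE; have [//|-> ->] := dec 7 (pair a b).
  by rewrite /= unpair_pair Da Db.
- exists (10 * pair a b + 8); rewrite decodeE; have [//|-> ->] := dec 8 (pair a b).
  by rewrite /= unpair_pair Da Db.
- exists (10 * a + 9); rewrite decodeE; have [//|-> ->] := dec 9 a.
  by rewrite /= Da.
Qed.

(* Every number congruent to 2 modulo 10 codes [CId], whence the padding. *)
Definition pad (c k : nat) : nat := 10 * pair c (10 * k + 2) + 6.

Lemma decode_pad c k : decode (pad c k) = CComp (decode c) CId.
Proof.
have dec t r : t < 10 -> (10 * r + t) %% 10 = t /\ (10 * r + t) %/ 10 = r by lia.
rewrite decodeE /pad; have [//|-> ->] := dec 6 (pair c (10 * k + 2)).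
rewrite /= unpair_pair /= (decodeE (10 * k + 2)).
by have [//|-> _] := dec 2 k.
Qed.

Lemma leq_pad c k : k <= pad c k.
Proof. by have := leq_pair c (10 * k + 2); rewrite /pad; lia. Qed.

(** The code searches for a zero of [1 - X (p e)], an expression independent of the search variable:
    it stops at once if the bit is 1 and never otherwise. *)
Lemma query_code p : computable_fun p ->
  exists c, forall (X : real) k, jump (set_of_real X) (pad c k) <-> X (p (pad c k)) = true.
Proof.
move=> [cp Hp].
have [cn Hn] : computable_fun (fun x => 1 - x) by computability.
have [c Dc] := decode_surj (CMin (CComp cn (CComp COrc (CComp cp CSnd)))).
exists c => X k; rewrite /jump decode_pad Dc; move: (pad c k) => e.
set O := set_oracle _; have funO : functional_oracle O by apply: set_functional.
have evp n : eval O (CComp cp CSnd) (pair n e) (p e).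
  by apply: ev_comp; [constructor | rewrite unpair_pair; apply/eval_empty/Hp].
split=> [[v H]|Xp].
  have [y ev1] := eval_comp_inv H; inversion ev1; subst y => /eval_min_inv ev0.
  have [y1 /eval_comp_inv[y2 ev3 /eval_orc_inv[b Ob ->]] ev2] := eval_comp_inv ev0.
  rewrite -(eval_fun O funO _ _ _ _ (evp v) ev3) in Ob.
  have := eval_fun O funO _ _ _ _ (eval_empty O _ _ _ (Hn b)) ev2.
  by case: b Ob {ev2} => // -[Hb _] _; apply: Hb.
exists 0; apply: ev_comp; first by constructor.
apply: (@ev_min O _ _ 0 (fun=> 0)) => //.
apply: (@ev_comp O _ _ _ 1); last exact/eval_empty/(Hn 1).
apply: ev_comp (evp 0) _.
by apply: (@ev_orc O (p e) true).
Qed.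

(* [test phi f e x m n i t] checks the witness [m], [n] for the string coded by
   [x] to disagree at [f e + e] with the output of [phi] on [e]; [m] is a guess
   for the oracle below [f e] and [n] bounds all the halting computations.
   [i] ranges over the oracle positions and [t] over the stages at which a
   wrong negative guess would be refuted. *)
Definition test (phi : nat) (f : nat -> nat) (e x m n i t : nat) : nat :=
  if shiftr x (f e + e).+1 == 0 then 0 else
  if (unpair (run m phi e n)).1 == 0 then
    if (unpair (run m phi e n)).2 == bit x (f e + e) then 0 else
    if i.+1 - f e == 0 then
      if odd i == 1 :> nat then
        if bit m i == 1 :> nat then
          if (unpair (run 0 i./2 i./2 n)).1 == 0 then 1 else 0
        else if (unpair (run 0 i./2 i./2 t)).1 == 0 then 0 else 1
      else if bit m i == bit x i./2 :> nat then 1 else 0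
    else 1
  else 0.

Lemma computable_test phi f e x m n i t : computable_fun f -> computable_fun e ->
  computable_fun x -> computable_fun m -> computable_fun n -> computable_fun i ->
  computable_fun t ->
  computable_fun (fun z => test phi f (e z) (x z) (m z) (n z) (i z) (t z)).
Proof.
move=> cf ce cx cm cn ci ct; rewrite /test; computability.
all: by apply: computable_run; computability.
Qed.

Lemma test_bool phi f e x m n i t :
  test phi f e x m n i t = 0 \/ test phi f e x m n i t = 1.
Proof. by rewrite /test; do ![case: ifP => _]; auto. Qed.

Lemma testP phi f e x m n i t : test phi f e x m n i t = 1 <->
  [/\ shiftr x (f e + e).+1 != 0, (unpair (run m phi e n)).1 = 0,
      (unpair (run m phi e n)).2 <> bit x (f e + e) &
      i < f e -> if odd i then
                   if bit m i then (unpair (run 0 i./2 i./2 n)).1 = 0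
                   else (unpair (run 0 i./2 i./2 t)).1 <> 0
                 else bit m i = bit x i./2].
Proof.
rewrite /test subn_eq0; case: eqP => [_|_]; first by split=> // -[].
case: eqP => [h|h]; last by split=> // -[].
case: eqP => [h'|h']; first by split=> // -[].
case: (i < f e); last by split.
case: (odd i) => /=.
  by case: (bit m i) => /=; case: eqP => h''; split=> // -[_ _ _ /(_ isT)].
by case: (bit m i); case: (bit x i./2); split=> // -[_ _ _ /(_ isT)].
Qed.

(** The inner universal statement fails by a witness [z] with [T <> 1], which is decidable. As 0 is
    the only number that codes no string, the condition on [T 0] keeps it out of the set. *)
Lemma SigmaStr2_test (T : nat -> nat -> nat -> nat) :
  computable_fun (fun u => T (unpair (unpair u).1).1 (unpair (unpair u).1).2 (unpair u).2) ->
  (forall x y z, T x y z = 0 \/ T x y z = 1) -> (forall y z, T 0 y z = 0) ->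
  SigmaStr 2 (fun s => exists y, forall z, T (str_code s) y z = 1).
Proof.
move=> [c Hc] T01 T0.
exists (fun w => forall z, T (unpair w).1 (unpair w).2 z = 1); split; last first.
  move=> x; split=> [[s [-> [y Hy]]]|[y Hy]].
    by exists y => z; rewrite unpair_pair.
  have Txy z : T x y z = 1 by have := Hy z; rewrite unpair_pair.
  have [|s Es] := str_code_surj x; last by exists s; rewrite -Es; split=> //; exists y.
  by case: x Txy {Hy} => // /(_ 0); rewrite T0.
exists (fun u => T (unpair (unpair u).1).1 (unpair (unpair u).1).2 (unpair u).2 <> 1); split.
  exists c => u; eexists; split; first exact: Hc.
  have [->|->] := T01 (unpair (unpair u).1).1 (unpair (unpair u).1).2 (unpair u).2.
    by right; split=> // h; apply: h.
  by left; split=> // h; apply: h.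
move=> w; split=> [/not_all_ex_not[z Hz]|[z Hz] /(_ z)].
  by exists z; rewrite unpair_pair.
by move: Hz; rewrite unpair_pair.
Qed.

(** Excluded middle settles for each [i < N] whether a stage exists; the maximum of the finitely
    many stages serves all. It yields the common stage confirming the positive answers of the
    halting set. *)
Lemma eventually_bounded (P : nat -> nat -> Prop) N :
  (forall i n k, n <= k -> P i n -> P i k) ->
  exists n, forall i, i < N -> (exists k, P i k) -> P i n.
Proof.
move=> monoP; elim: N => [|N [n Hn]]; first by exists 0.
case: (classic (exists k, P N k)) => [[k Hk]|no].
  exists (maxn n k) => i; rewrite ltnS leq_eqVlt => /orP[/eqP-> _|/Hn h /h].
    exact: monoP (leq_maxr n k) Hk.
  exact/monoP/leq_maxl.
by exists n => i; rewrite ltnS leq_eqVlt => /orP[/eqP->|]; [move/no | apply: Hn].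
Qed.

(** * Genericity against the diagonal set *)

Theorem mainTheorem1 (X : real) :
  generic 2 X ->
  ~ tt_le (jump (set_of_real X)) (join (set_of_real X) halting).
Proof.
move=> genX [Phi [[f [cf ttPhi]] PhiX]].
set B := join _ _ in PhiX.
have [phi Dphi] := decode_surj Phi.
have cp : computable_fun (fun e => f e + e) by computability.
have [c jumpX] := query_code _ cp.
(* The witness [y] codes the padding parameter, the guessed oracle and the stage; [z] codes an
   oracle position and a refutation stage. *)
pose T x y z := test phi f (pad c (unpair y).1) x (unpair (unpair y).2).1
  (unpair (unpair y).2).2 (unpair z).1 (unpair z).2.
have Sigma2 : SigmaStr 2 (fun s => exists y, forall z, T (str_code s) y z = 1).
  apply: SigmaStr2_test.
  - by apply: computable_test => //; rewrite /pad; computability.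
  - by move=> *; apply: test_bool.
  - by move=> y z; rewrite /T /test shiftr0.
(* By the truth-table bound, the first [f e] bits of the oracle already determine the output on
   [e]. *)
have tt_bits m e : exists v, eval (bit_oracle m) Phi e v /\
    ((forall i, i < f e -> bit m i = true <-> B i) -> eval (set_oracle B) Phi e v).
  have [|v Hv] := ttPhi e (mkseq (bit m) (f e)); first by rewrite size_mkseq.
  exists v; split; first apply: eval_mono Hv => i b.
    by rewrite /str_oracle size_mkseq => -[lti <-]; rewrite nth_mkseq.
  move=> mB; apply: eval_mono Hv => i b.
  by rewrite /str_oracle size_mkseq => -[lti <-]; rewrite nth_mkseq //; apply: mB.
(* If an initial segment of [X] lies in the set, the witness [y] exposes a wrong output of the
   reduction. *)
case: (genX _ Sigma2) => [[l [y Hy]]|[l Hl]].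
  pose e := pad c (unpair y).1; pose m := (unpair (unpair y).2).1.
  pose n := (unpair (unpair y).2).2.
  have test1 i t := (testP phi f e (str_code (restr X l)) m n i t).1.
  have {test1}Hy1 i t := test1 i t ltac:(by have := Hy (pair i t); rewrite /T unpair_pair).
  have [+ hn out_neq _] := Hy1 0 0.
  rewrite shiftr_str_code size_mkseq => lt_pl.
  have bitX i : i < l -> bit (str_code (restr X l)) i = X i.
    by move=> ltil; rewrite bit_str_code ?size_mkseq // nth_mkseq.
  (* The guess is right: even positions copy [X], positive answers halt by stage [n], and negative
     ones are refuted at no stage [t]. *)
  have mB i : i < f e -> bit m i = true <-> B i.
    move=> lti; rewrite /B /join; have := fun t => let: And4 _ _ _ h := Hy1 i t in h lti.
    case: (odd i) => [|/(_ 0) ->]; last by rewrite bitX //; lia.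
    rewrite halting_run; case: (bit m i) => h; first by split=> // _; exists n; apply: h 0.
    by split=> // -[t ht]; case: (h t).
  have [v [Hv /(_ mB) HvB]] := tt_bits m e.
  have := run_sound _ _ _ _ hn; rewrite Dphi => /(eval_fun _ (bit_functional m) _ _ _ _ Hv) Ev.
  have [v' [Hv' vA]] := PhiX e.
  (* The tested output is thus the true one, which decides whether [e] is in the jump, that is, the
     bit of [X] at [f e + e]. *)
  move: out_neq; rewrite -Ev (eval_fun _ (set_functional B) _ _ _ _ HvB Hv') bitX //.
  move: vA; rewrite jumpX; case: (X _) => -[[h ->]|[h ->]] //.
(* Otherwise no extension of [restr X l] is in the set. Padding by [l] gives [l <= e], so the
   position [f e + e] is not fixed by [restr X l]. *)
have := leq_pad c l; set e := pad c l => le_le.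
have [s [size_s Hs]] := set_initial_segment B (f e).
have [m Hm] := bits_of_seq s.
have [v [Hv _]] := tt_bits m e.
have [|n0 Hn0] := run_complete m phi e v; first by rewrite Dphi.
have [|n1 Hn1] := eventually_bounded (fun i n => (unpair (run 0 i./2 i./2 n)).1 = 0) (f e).
  by move=> i n k le_nk h; rewrite (run_halted _ _ _ _ _ le_nk h).
(* The last bit [v != 1] differs from [v] whatever number [v] is. The oracle below [f e] only
   queries [X] below [p], where [t] agrees with [X]. *)
set p := f e + e; pose t := rcons (restr X p) (v != 1).
have size_t : size t = p.+1 by rewrite size_rcons size_mkseq.
have bitX i : i < p -> bit (str_code t) i = X i.
  by move=> ltip; rewrite bit_str_code ?size_t ?ltnS ?(ltnW ltip) // nth_rcons size_mkseq ltip nth_mkseq.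
have bitp : bit (str_code t) p = (v != 1).
  by rewrite bit_str_code ?size_t // nth_rcons size_mkseq ltnn eqxx.
apply: (Hl t).
  have -> : t = restr X l ++ rcons (map X (iota l (p - l))) (v != 1).
    by rewrite -rcons_cat -map_cat -iotaD subnKC //; lia.
  exact: prefix_prefix.
(* The guess [m] is the true oracle; [n0] bounds the run of [phi], and [n1] the confirmations. *)
exists (pair l (pair m (maxn n0 n1))) => z; rewrite /T !unpair_pair /= -/e.
have En : run m phi e (maxn n0 n1) = pair 0 v.
  by rewrite (run_halted m phi e n0) ?leq_maxl // Hn0 ?unpair_pair.
apply/testP; rewrite En unpair_pair -/p bitp shiftr_str_code size_t; split=> //.
  by case: eqP => [->|].
move: (unpair z).1 (unpair z).2 => i k lti; have := Hs i lti; rewrite -Hm /B /join.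
case: (odd i) => h; last by rewrite bitX; [apply/idP/idP => /h | lia].
rewrite halting_run in h; case: (bit m i) h => -[h1 h2].
  rewrite (run_halted _ _ _ n1) ?leq_maxr //; apply: Hn1 => //; exact: h1.
by move=> hk; have := h2 (ex_intro _ k hk).
Qed.
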